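(* Let $-\infty<\beta_1<\alpha_1<\beta_2<\alpha_2<\beta_3<\alpha_3<\infty$, let $a,b\in\mathbb{C}$ with $|a|^2+|b|^2=1$ and $0<|b|<1$, and let $$B=\begin{pmatrix}0&a&b\\0&-\overline b&\overline a\\1&0&0\end{pmatrix}\in U(3),\qquad B'_{\alpha,\beta}(\lambda)=\begin{pmatrix}a\,e_\lambda(\beta_2-\alpha_1)&b\,e_\lambda(\beta_3-\alpha_1)\\-\overline b\,e_\lambda(\beta_2-\alpha_2)&\overline a\,e_\lambda(\beta_3-\alpha_2)\end{pmatrix}.$$ Let $L_1=\beta_2-\alpha_1$ and $L_2=\beta_3-\alpha_2$ be the lengths of the two bounded intervals $J_1=(\alpha_1,\beta_2)$ and $J_2=(\alpha_2,\beta_3)$. Then $$D(\lambda,a,L_1,L_2):=\det\big(I_2-B'_{\alpha,\beta}(\lambda)\big)=1+e_\lambda(L_1+L_2)-a\,e_\lambda(L_1)-\overline a\,e_\lambda(L_2).$$ The embedded point-spectrum $\Lambda_{pt}$ of $P_B$ is the set of zeros $$Z(a,L_1,L_2):=\{\lambda\in\mathbb{R}: D(\lambda,a,L_1,L_2)=0\}$$ of this exponential polynomial. Moreover, setting $a=w\,e(\varphi_0)$ with $0<w<1$, the equation $D(\lambda,a,L_1,L_2)=0$ is equivalent to $$e(\lambda L_2-\varphi_0)=\frac{1-w\,e(\lambda L_1+\varphi_0)}{w-e(\lambda L_1+\varphi_0)}.$$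
   Context: Notation: $e(x)=e^{i2\pi x}$, $e_\lambda(x)=e^{i2\pi\lambda x}$, and $\varphi_0\in\mathbb{R}$. $\Omega=(-\infty,\beta_1)\cup J_1\cup J_2\cup(\alpha_3,\infty)$, and $P_B=\frac{1}{i2\pi}\frac{d}{dx}$ is the selfadjoint operator in $L^2(\Omega)$ with domain the set of $f\in L^2(\Omega)$, absolutely continuous on components with $f'\in L^2(\Omega)$, and $B(f(\beta_1),f(\beta_2),f(\beta_3))^T=(f(\alpha_1),f(\alpha_2),f(\alpha_3))^T$, where $f(\beta_i)$, $f(\alpha_i)$ are limits from the left, resp. right. The embedded point-spectrum of $P_B$ is its set of eigenvalues. *)

(* Defs.v *)
From HB Require Import structures.
From mathcomp Require Import all_boot all_order all_algebra.
From mathcomp Require Import complex.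
From mathcomp Require Import all_classical all_reals all_analysis.

Set Implicit Arguments.
Unset Strict Implicit.
Unset Printing Implicit Defensive.

Import Order.TTheory GRing.Theory Num.Theory.
Import numFieldNormedType.Exports.

Local Open Scope classical_set_scope.
Local Open Scope ring_scope.
Local Open Scope complex_scope.

Notation normc := ComplexField.Normc.normc.

(* e(x) = exp(i 2 pi x) *)
Definition e {R : realType} (x : R) : R[i] :=
  cos (2 * pi * x) +i* sin (2 * pi * x).

Definition e_ {R : realType} (lambda x : R) : R[i] := e (lambda * x).

Section Operator.
Variable R : realType.
Implicit Types (f g df : R -> R[i]) (D J : set R).

Definition ae_eq_on D f g :=
  {ae (@lebesgue_measure R), forall x, D x -> f x = g x}.

(* Functions stand for their a.e. classes, of which f is a Borel
   representative. *)
Definition L2 D f :=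
  [/\ measurable_fun D (fun x => complex.Re (f x)),
      measurable_fun D (fun x => complex.Im (f x)) &
      (\int[@lebesgue_measure R]_(x in D) ((normc (f x)) ^+ 2)%:E < +oo)%E].

Definition abs_continuous_on J f :=
  forall eps : R, 0 < eps -> exists2 delta : R, 0 < delta &
    forall (n : nat) (s t : 'I_n -> R),
      (forall k, s k <= t k /\ `[s k, t k]%classic `<=` J) ->
      trivIset setT (fun k => `]s k, t k[%classic) ->
      \sum_(k < n) (t k - s k) < delta ->
      \sum_(k < n) normc (f (t k) - f (s k)) < eps.

(* R[i] has no normed R-module structure, so that the library's derivative is
   not available for functions from R to R[i]; convergence is in R[i]^o, for
   the topology of the complex norm. *)
Definition has_derivative f (x : R) (l : R[i]) :=
  (h^-1)%:C * (f (x + h) - f x) @[h --> 0^'] --> (l : R[i]^o).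

Definition ae_derivative_on D f df :=
  {ae (@lebesgue_measure R), forall x, D x -> has_derivative f x (df x)}.

Definition col3 (T : Type) (x y z : T) : 'cV[T]_3 :=
  \col_(i < 3) nth x [:: x; y; z] i.

Variables (beta1 alpha1 beta2 alpha2 beta3 alpha3 : R).

Definition J0 : set R := `]-oo, beta1[%classic.
Definition J1 : set R := `]alpha1, beta2[%classic.
Definition J2 : set R := `]alpha2, beta3[%classic.
Definition J3 : set R := `]alpha3, +oo[%classic.
Definition Omega : set R := J0 `|` J1 `|` J2 `|` J3.

Definition boundary_condition (B : 'M[R[i]]_3) f :=
  exists p1 p2 p3 q1 q2 q3 : R[i],
    [/\ f x @[x --> beta1^'-] --> (p1 : R[i]^o),
        f x @[x --> beta2^'-] --> (p2 : R[i]^o) &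
        f x @[x --> beta3^'-] --> (p3 : R[i]^o)] /\
    [/\ f x @[x --> alpha1^'+] --> (q1 : R[i]^o),
        f x @[x --> alpha2^'+] --> (q2 : R[i]^o) &
        f x @[x --> alpha3^'+] --> (q3 : R[i]^o)] /\
    B *m col3 p1 p2 p3 = col3 q1 q2 q3.

(* f is the absolutely continuous representative of an element of the domain
   of P_B, and df is any representative of its derivative. *)
Definition P_B_dom (B : 'M[R[i]]_3) f df :=
  [/\ L2 Omega f,
      [/\ abs_continuous_on J0 f, abs_continuous_on J1 f,
          abs_continuous_on J2 f & abs_continuous_on J3 f],
      ae_derivative_on Omega f df /\ L2 Omega df &
      boundary_condition B f].

(* The graph of P_B = (i 2 pi)^-1 d/dx. *)
Definition P_B (B : 'M[R[i]]_3) f g :=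
  exists2 df, P_B_dom B f df & forall x, g x = ('i * (2 * pi)%:C)^-1 * df x.

(* Eigenvalues are taken in R[i], since P_B acts in a complex Hilbert space;
   that they are real is not built in. *)
Definition point_spectrum (B : 'M[R[i]]_3) : set R[i] :=
  [set z | exists f g : R -> R[i],
    [/\ P_B B f g,
        ~ ae_eq_on Omega f (fun=> 0) &
        ae_eq_on Omega g (fun x => z * f x)]].

End Operator.

Section Matrices.
Variable R : realType.
Implicit Types a b : R[i].

Definition mx_B a b : 'M[R[i]]_3 :=
  \matrix_(i < 3, j < 3)
    nth 0 (nth [::] [:: [:: 0;     a;   b];
                        [:: 0; - b^*; a^*];
                        [:: 1;     0;   0]] i) j.

Definition mx_B' (alpha1 beta2 alpha2 beta3 : R) a b (lambda : R) :
    'M[R[i]]_2 :=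
  \matrix_(i < 2, j < 2)
    nth 0 (nth [::]
      [:: [:: a * e_ lambda (beta2 - alpha1);
              b * e_ lambda (beta3 - alpha1)];
          [:: - b^* * e_ lambda (beta2 - alpha2);
              a^* * e_ lambda (beta3 - alpha2)]] i) j.

Definition D (lambda : R) a (L1 L2 : R) : R[i] :=
  1 + e_ lambda (L1 + L2) - a * e_ lambda L1 - a^* * e_ lambda L2.

Definition Z a (L1 L2 : R) : set R := [set lambda | D lambda a L1 L2 = 0].

End Matrices.

(* Main.v *)
Require Import Defs.
From HB Require Import structures.
From mathcomp Require Import all_boot all_order all_algebra.
From mathcomp Require Import complex.
From mathcomp Require Import all_classical all_reals all_analysis.
From mathcomp Require Import measurable_realfun.
From mathcomp Require Import ring lra.
Import Order.TTheory GRing.Theory Num.Theory.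
Import numFieldNormedType.Exports.
Local Open Scope classical_set_scope.
Local Open Scope ring_scope.
Local Open Scope complex_scope.
Set Implicit Arguments.
Unset Strict Implicit.
Unset Printing Implicit Defensive.

(** An eigenfunction solves [f' = 2 i pi z f] almost everywhere, and absolute
    continuity makes it [C exp (2 i pi z x)] on each component of [Omega].
    Square integrability on the two half-lines forces [Im z < 0] if [f] does not
    vanish on the left one and [Im z > 0] if it does not vanish on the right
    one; the third boundary condition says that both or neither happen, so [f]
    lives on the two bounded intervals. There the other two conditions say that
    a unitary 2x2 matrix sends the right end values to the left end values.
    If [z] were not real, the moduli would both grow or both decrease along
    the intervals, contradicting unitarity. For real [z], a nonzero solution
    exists iff the determinant [D] vanishes. *)

(** * Convergence and differentiation in [R[i]] *)

Lemma normc_triangle (R : realType) (x y : R[i]) :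
  normc (x + y) <= normc x + normc y.
Proof. exact: le_normcD. Qed.

Lemma normr_normc (R : realType) (x : R[i]) : `|x| = (normc x)%:C.
Proof. by []. Qed.

Lemma normc_nonneg (R : realType) (x : R[i]) : 0 <= normc x.
Proof. by case: x => u v; rewrite sqrtr_ge0. Qed.

Lemma normc_real (R : realType) (x : R) : normc x%:C = `|x|.
Proof. by rewrite /= expr0n addr0 sqrtr_sqr. Qed.

(** A positive element of [R[i]] has zero imaginary part, so testing real [eps] is enough. *)
Lemma cvg_normcP (R : realType) (T : Type) (F : set_system T)
    (FF : Filter F) (f : T -> R[i]) (l : R[i]) :
  f x @[x --> F] --> (l : R[i]^o) <->
  forall eps : R, 0 < eps -> \forall x \near F, normc (f x - l) < eps.
Proof.
split=> [/(@cvgrPdistC_lt R[i] R[i]^o) H eps e0|H].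
  have e0c : 0 < eps%:C by rewrite ltcR.
  by apply: filterS (H _ e0c) => x; rewrite normr_normc ltcR.
apply/(@cvgrPdistC_lt R[i] R[i]^o) => -[er ei]; rewrite ltcE /= => /andP[/eqP-> e0].
by apply: filterS (H _ e0) => x; rewrite normr_normc ltcR.
Qed.

(** Clearing the quotient gives a bound that still makes sense at [h = 0]; in the converse,
    [eps / 2] restores the strict inequality. *)
Lemma has_derivativeP (R : realType) (f : R -> R[i]) (x : R) (l : R[i]) :
  has_derivative f x l <->
  forall eps : R, 0 < eps -> exists2 d : R, 0 < d &
    forall h, `|h| < d -> normc (f (x + h) - f x - h%:C * l) <= eps * `|h|.
Proof.
have key h : h != 0 -> normc ((h^-1)%:C * (f (x + h) - f x) - l) =
    `|h|^-1 * normc (f (x + h) - f x - h%:C * l).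
  move=> h0; rewrite -normfV -normc_real -ComplexField.Normc.normcM; congr normc.
  by rewrite [RHS]mulrBr [X in _ = _ - X]mulrA -rmorphM /= mulVf // mul1r.
split.
  move/cvg_normcP => H eps e0; have := H eps e0.
  rewrite near_withinE => /nbhs_ballP[d /= d0 Hd]; exists d => // h hd.
  have [->|h0] := eqVneq h 0.
    by rewrite addr0 subrr mul0r subr0 normr0 mulr0 ComplexField.Normc.normc0.
  have := Hd h; rewrite /ball /= sub0r normrN => /(_ hd h0).
  by rewrite key // mulrC ltr_pdivrMr ?normr_gt0// => /ltW.
move=> H; apply/cvg_normcP => eps e0.
have [d d0 Hd] := H (eps / 2) (divr_gt0 e0 (ltr0Sn _ 1)).
rewrite near_withinE; apply/nbhs_ballP; exists d => //= h.
rewrite /ball /= sub0r normrN => /Hd {}Hd h0.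
rewrite key // mulrC ltr_pdivrMr ?normr_gt0//; apply: le_lt_trans Hd _.
by rewrite ltr_pM2r ?normr_gt0// ltr_pdivrMr// ltr_pMr// ltr1n.
Qed.

Lemma negligible_open_cover (R : realType) (N : set R) (delta : R) :
  (@lebesgue_measure R).-negligible N -> 0 < delta ->
  exists U : set R, [/\ open U, N `<=` U & (lebesgue_measure U < delta%:E)%E].
Proof.
move=> [A [mA muA0 NA]] d0.
have A0 : lebesgue_measure A = 0%E := muA0.
have [|U [oU AU mU]] := lebesgue_regularity_outer mA _ d0;
  first by rewrite [X in (X < _)%E]A0 ltry.
exists U; split => //; first exact: subset_trans AU.
(* Outer regularity controls only the excess of [U] over [A]; since [A] is null, this is the whole
   measure of [U]. *)
rewrite -(setDUK AU); apply: le_lt_trans mU.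
have mUA : measurable (U `\` A) by apply: measurableD => //; exact: open_measurable.
by apply: le_trans (measureU2 _ mA mUA) _; rewrite [X in (X + _)%E]A0 add0e.
Qed.

(** The open intervals are disjoint and lie in [U], so additivity and monotonicity of the measure
    apply to their union. *)
Lemma sum_length_le (R : realType) (U : set R) (n : nat) (u v : 'I_n -> R) :
  measurable U -> (forall k, u k <= v k /\ `[u k, v k]%classic `<=` U) ->
  trivIset setT (fun k => `]u k, v k[%classic) ->
  ((\sum_(k < n) (v k - u k))%:E <= lebesgue_measure U)%E.
Proof.
move=> mU H tr.
have -> : (\sum_(k < n) (v k - u k))%:E =
    (\sum_(k < n) lebesgue_measure (`]u k, v k[%classic : set R))%E.
  rewrite -sumEFin; apply: eq_bigr => k _; rewrite lebesgue_measure_itv /= lte_fin.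
  by case: ltgtP (H k).1 => // -> _; rewrite subrr.
rewrite -measure_bigsetU_ord//; apply: le_measure; rewrite ?inE//.
  by apply: bigsetU_measurable.
rewrite -bigcup_seq => x [k _] /= xk; apply: (H _).2; exact: subset_itv_oo_cc xk.
Qed.

(** * Absolute continuity *)

Lemma abs_continuous_on_subset (R : realType) (J K : set R) (f : R -> R[i]) :
  K `<=` J -> abs_continuous_on J f -> abs_continuous_on K f.
Proof.
move=> KJ fJ eps e0; have [d d0 Hd] := fJ _ e0; exists d => // n s t st.
by apply: Hd => k; split; [exact: (st k).1|exact: subset_trans (st k).2 KJ].
Qed.

(* Continuous induction on the right end x of [s, x]: near a point where the
   derivative vanishes, F grows by at most eps times the length; every other
   point lies in an open set U of small measure, so that an interval around it
   can be added to the list [u, v] of intervals on which absolute continuity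
   controls F. *)
Lemma abs_continuous_derivative0 (R : realType) (F : R -> R[i]) (s t : R) :
  s <= t -> abs_continuous_on `[s, t]%classic F ->
  {ae (@lebesgue_measure R),
    forall x, `[s, t]%classic x -> has_derivative F x 0} ->
  F t = F s.
Proof.
move=> st acF aeF; apply/eqP; rewrite -subr_eq0; apply/eqP.
apply: ComplexField.Normc.eq0_normc; apply/eqP; rewrite eq_le normc_nonneg andbT.
apply/ler_addgt0Pl => eps0 eps00; rewrite addr0.
(* Chosen so that [eps * (t - s) + eps] is exactly [eps0]; the added 1 keeps the denominator
   positive when [s = t]. *)
pose eps := eps0 / (t - s + 1).
have ts1 : 0 < t - s + 1 by rewrite ltr_wpDl// subr_ge0.
have e0 : 0 < eps by rewrite divr_gt0.
suff : normc (F t - F s) <= eps * (t - s) + eps.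
  have -> // : eps * (t - s) + eps = eps0.
  by rewrite -[X in _ + X]mulr1 -mulrDr divfK// gt_eqF.
have [d d0 acFd] := acF _ e0.
have [U [oU NU mU]] := negligible_open_cover aeF d0.
pose P x := s <= x <= t /\ exists (n : nat) (u v : nat -> R),
  [/\ forall k, (k < n)%N ->
        [/\ s <= u k, u k <= v k, v k <= x & `[u k, v k]%classic `<=` U],
      forall j k, (j < k < n)%N -> v j <= u k &
      normc (F x - F s) <= eps * (x - s) +
        \sum_(k < n) normc (F (v k) - F (u k))].
(* At [x = t] the listed intervals lie in [U], so their total length is below [d] and their
   contribution is below [eps]. *)
suff [_ [n [u [v [uv uv_disj]]]]] : P t.
  move=> /le_trans; apply; rewrite lerD2l.
  have uvk (k : 'I_n) : u k <= v k /\ `[u k, v k]%classic `<=` U.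
    by have [] := uv k (ltn_ord k).
  have tr : trivIset setT (fun k : 'I_n => `]u k, v k[%classic).
    move=> j k _ _ [x [/=]]; rewrite !in_itv /= => /andP[xj1 xj2] /andP[xk1 xk2].
    apply/eqP/negP => /negP; rewrite neq_ltn => /orP[jk|jk].
      have := uv_disj j k; rewrite jk ltn_ord => /(_ isT) vu.
      by have := lt_trans xj2 (le_lt_trans vu xk1); rewrite ltxx.
    have := uv_disj k j; rewrite jk ltn_ord => /(_ isT) vu.
    by have := lt_trans xk2 (le_lt_trans vu xj1); rewrite ltxx.
  apply/ltW/(acFd n (u \o @nat_of_ord n) (v \o @nat_of_ord n)) => //=.
    move=> k; have [su uv' vt _] := uv k (ltn_ord k); split=> // x /=.
    rewrite !in_itv /= => /andP[ux xv].
    by rewrite (le_trans su ux) (le_trans xv vt).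
  rewrite -lte_fin; apply: le_lt_trans mU.
  by apply: sum_length_le => //; exact: open_measurable.
(* The step straddles [c], so at a supremum it can start from a nearby point below, without knowing
   [P c]. *)
have step c : s <= c <= t -> exists2 r, 0 < r &
    forall x y, c - r < x <= c -> c <= y < c + r -> y <= t -> P x -> P y.
  move=> sct; have [Uc|Uc] := pselect (U c).
    have /nbhs_ballP[r /= r0 cU] : nbhs c U by exact: open_nbhs_nbhs.
    exists r => // x y /andP[cx xc] /andP[cy yc] yt.
    case=> /andP[sx xt] [n [u [v [uv uv_disj Fx]]]].
    split; first by rewrite yt (le_trans sx (le_trans xc cy)).
    (* The interval from [x] to [y] is appended at index [n], and its increment of [F] enters the
       sum. *)
    exists n.+1, (fun k => if k == n then x else u k),
      (fun k => if k == n then y else v k); split.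
    - move=> k; rewrite ltnS leq_eqVlt; case: eqP => [_ _|_ /= kn].
        split=> //; first exact: le_trans xc cy.
        move=> z /=; rewrite in_itv /= => /andP[xz zy]; apply: cU.
        by rewrite /ball /= ltr_distlC; lra.
      have [? ? vx ?] := uv k kn; split=> //; exact: le_trans vx (le_trans xc cy).
    - move=> j k /andP[jk]; rewrite ltnS => kn.
      rewrite ltn_eqF ?(leq_trans jk kn)//; case: eqP => [kn'|/eqP kn'].
        by have [] := uv j (leq_trans jk kn).
      by apply: uv_disj; rewrite jk ltn_neqAle kn' kn.
    - rewrite big_ord_recr /= eqxx.
      have -> : F y - F s = (F y - F x) + (F x - F s) by rewrite addrA subrK.
      apply: le_trans (normc_triangle _ _) _.
      rewrite [leLHS]addrC [leRHS]addrA lerD2r.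
      apply: le_trans Fx _; apply: lerD.
        by rewrite ler_pM2l// lerD2r (le_trans xc cy).
      apply: ler_sum => k _; rewrite ltn_eqF//.
  (* Outside [U] the derivative vanishes, and passing from [x] to [y] through [c] costs at most
     [eps * (y - x)]. *)
  have /has_derivativeP/(_ _ e0)[r r0 Hr] : has_derivative F c 0.
    apply: contrapT => nd; apply: Uc; apply: NU => cP; apply/nd/cP.
    by rewrite /= in_itv /=; case/andP: sct => -> ->.
  have {}Hr h : `|h| < r -> normc (F (c + h) - F c) <= eps * `|h|.
    by move=> /Hr; rewrite mulr0 subr0.
  exists r => // x y /andP[cx xc] /andP[cy yc] yt.
  case=> /andP[sx xt] [n [u [v [uv uv_disj Fx]]]].
  split; first by rewrite yt (le_trans sx (le_trans xc cy)).
  exists n, u, v; split=> //.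
    move=> k /uv[? ? vx ?]; split=> //; exact: le_trans vx (le_trans xc cy).
  have -> : F y - F s = (F y - F c) + ((F c - F x) + (F x - F s)).
    by rewrite !addrA !subrK.
  apply: le_trans (normc_triangle _ _) _.
  have Fy : normc (F y - F c) <= eps * (y - c).
    have := Hr (y - c); rewrite (addrC c) subrK ger0_norm ?subr_ge0//; apply; lra.
  have Fc : normc (F c - F x) <= eps * (c - x).
    have := Hr (x - c); rewrite (addrC c) subrK distrC ger0_norm ?subr_ge0// => Hx.
    by rewrite -normcN opprB; apply: Hx; lra.
  have := normc_triangle (F c - F x) (F x - F s); lra.
have Ps : P s.
  split; first by rewrite lexx.
  exists 0%N, (fun=> 0), (fun=> 0); split=> //.
  by rewrite !subrr mulr0 big_ord0 addr0 ComplexField.Normc.normc0.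
have supP : has_sup [set x | P x].
  by split; [exists s|exists t => x [/andP[]]].
pose c := sup [set x | P x].
have sc : s <= c by apply: ub_le_sup => //; exact: supP.2.
have ct : c <= t by apply: ge_sup; [exists s|move=> x [/andP[]]].
have [|r r0 Hr] := step c; first by rewrite sc.
have [x Px cx] := sup_adherent r0 supP.
have xc : x <= c by apply: ub_le_sup => //; exact: supP.2.
have [ctr|ctr] := ltP t (c + r).
  by apply: (Hr x t) => //; rewrite ?cx ?ct.
(* If [c + r <= t], the step reaches [c + r / 2], beyond the supremum. *)
have := Hr x (c + r / 2); rewrite cx xc => /(_ isT).
have cr : c <= c + r / 2 < c + r by lra.
rewrite cr => /(_ isT) H.
have /H/(_ Px) Pcr : c + r / 2 <= t by lra.
have : c + r / 2 <= c by apply: ub_le_sup => //; exact: supP.2.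
lra.
Qed.

(** * The complex exponential *)

Lemma normc_le_ReIm (R : realType) (x : R[i]) :
  normc x <= `|complex.Re x| + `|complex.Im x|.
Proof.
case: x => u v /=; rewrite -[leRHS]ger0_norm ?addr_ge0//.
rewrite -[leRHS]sqrtr_sqr ler_wsqrtr// sqrrD !real_normK ?num_real//.
by rewrite lerD2r lerDl mulrn_wge0// mulr_ge0.
Qed.

Lemma le_Re_normc (R : realType) (x : R[i]) : `|complex.Re x| <= normc x.
Proof.
by case: x => u v /=; rewrite -sqrtr_sqr ler_wsqrtr// lerDl sqr_ge0.
Qed.

Lemma le_Im_normc (R : realType) (x : R[i]) : `|complex.Im x| <= normc x.
Proof.
by case: x => u v /=; rewrite -sqrtr_sqr ler_wsqrtr// lerDr sqr_ge0.
Qed.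

(** Real and imaginary parts of the difference quotient converge separately, each within [eps / 2];
    this carries real calculus over to [has_derivative]. *)
Lemma has_derivative_complex (R : realType) (u v : R -> R) (x du dv : R) :
  is_derive x 1 u du -> is_derive x 1 v dv ->
  has_derivative (fun y => u y +i* v y) x (du +i* dv).
Proof.
have cvg_quot (w : R -> R) dw : is_derive x 1 w dw ->
    h^-1 * (w (x + h) - w x) @[h --> 0^'] --> dw.
  case=> ew <-; have -> : (fun h => h^-1 * (w (x + h) - w x)) =
      (fun h => h^-1 *: ((w \o shift x) (h *: 1) - w x)).
    by apply/funext => h; rewrite /= [h *: 1]mulr1 (addrC x).
  exact: ew.
move=> /cvg_quot/cvgrPdistC_lt Hu /cvg_quot/cvgrPdistC_lt Hv.
apply/cvg_normcP => eps e0; have e2 : 0 < eps / 2 by rewrite divr_gt0.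
near=> h; apply: le_lt_trans (normc_le_ReIm _) _.
rewrite /= mul0r mul0r subr0 addr0 [ltRHS](splitr eps); apply: ltrD.
- by near: h; apply: Hu.
- by near: h; apply: Hv.
Unshelve. all: by end_near. Qed.

Lemma is_derive_lipschitz (R : realType) (u du : R -> R) (s t K : R) :
  (forall x : R, is_derive x 1 u (du x)) ->
  (forall x, s <= x <= t -> `|du x| <= K) ->
  forall x y, s <= x <= t -> s <= y <= t -> `|u y - u x| <= K * `|y - x|.
Proof.
move=> du_u duK x y; wlog xy : x y / x <= y.
  move=> H xs ys; have [xy|/ltW yx] := leP x y; first exact: H.
  by rewrite distrC (distrC y); apply: H.
move=> /andP[sx xt] /andP[sy yt].
have [|c] := @MVT_segment R u du x y xy.
  by apply: derivable_within_continuous => z _; apply: ex_derive.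
rewrite in_itv /= => /andP[xc cy] ->; rewrite normrM ler_wpM2r// duK//.
by rewrite (le_trans sx xc) (le_trans cy yt).
Qed.

Definition cexp (R : realType) (z : R[i]) : R[i] :=
  (expR (complex.Re z) * cos (complex.Im z)) +i*
  (expR (complex.Re z) * sin (complex.Im z)).

Lemma cexpD (R : realType) (z w : R[i]) : cexp (z + w) = cexp z * cexp w.
Proof.
case: z w => [p q] [p' q']; rewrite /cexp /= expRD cosD sinD.
by apply/eqP; rewrite eq_complex /=; apply/andP; split; apply/eqP; ring.
Qed.

Lemma cexp0 (R : realType) : cexp (0 : R[i]) = 1.
Proof. by rewrite /cexp /= expR0 cos0 sin0 mulr1 mulr0. Qed.

Lemma normc_cexp (R : realType) (z : R[i]) : normc (cexp z) = expR (complex.Re z).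
Proof.
rewrite /cexp /= !exprMn -mulrDr cos2Dsin2 mulr1 sqrtr_sqr ger0_norm//.
Qed.

Lemma cexp_neq0 (R : realType) (z : R[i]) : cexp z != 0.
Proof.
apply/eqP => /(congr1 (@ComplexField.Normc.normc R)).
by rewrite normc_cexp ComplexField.Normc.normc0; apply/eqP; rewrite gt_eqF ?expR_gt0.
Qed.

Lemma cexpN (R : realType) (z : R[i]) : cexp (- z) = (cexp z)^-1.
Proof.
by apply: (mulIf (cexp_neq0 z)); rewrite -cexpD addNr cexp0 mulVf// cexp_neq0.
Qed.

Lemma e_cexp (R : realType) (x : R) : e x = cexp (x%:C * ('i * (2 * pi)%:C)%R).
Proof.
rewrite -complexiE /e /cexp /= !(mul0r, mul1r, mulr0, mulr1, add0r, addr0, subr0).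
by rewrite oppr0 mulr0 expR0 !mul1r (mulrC x).
Qed.

(** * The exponential along the real line *)

Section CexpLine.
Variables (R : realType) (p q : R).
Let u x := expR (p * x) * cos (q * x).
Let v x := expR (p * x) * sin (q * x).

Let cexp_lineE x : cexp (x%:C * (p +i* q)) = u x +i* v x.
Proof. by rewrite /cexp /= !mul0r subr0 addr0 !(mulrC x). Qed.

Let d_scale (k x : R) : is_derive x 1 ( *%R k) k.
Proof.
rewrite -[X in is_derive _ _ _ X]mulr1.
exact: (@is_deriveZ _ _ _ id k x 1 1).
Qed.

Let d_exp (x : R) : is_derive x 1 (expR \o *%R p) (expR (p * x) * p).
Proof. exact: is_derive1_comp. Qed.

Let d_u (x : R) : is_derive x 1 u (p * u x - q * v x).
Proof.
have d_cos : is_derive x 1 (cos \o *%R q) (- sin (q * x) * q).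
  exact: is_derive1_comp.
have := is_deriveM (d_exp x) d_cos.
rewrite (_ : _ + _ = p * u x - q * v x)//.
by rewrite /u /v /GRing.scale /=; ring.
Qed.

Let d_v (x : R) : is_derive x 1 v (q * u x + p * v x).
Proof.
have d_sin : is_derive x 1 (sin \o *%R q) (cos (q * x) * q).
  exact: is_derive1_comp.
have := is_deriveM (d_exp x) d_sin.
rewrite (_ : _ + _ = q * u x + p * v x)//.
by rewrite /u /v /GRing.scale /=; ring.
Qed.

Lemma cexp_line_derivative x :
  has_derivative (fun y => cexp (y%:C * (p +i* q))) x
    ((p +i* q) * cexp (x%:C * (p +i* q))).
Proof.
rewrite (_ : (fun _ => _) = fun y => u y +i* v y); last first.
  by apply/funext => y; rewrite cexp_lineE.
rewrite cexp_lineE (_ : _ * _ =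
  (p * u x - q * v x) +i* (q * u x + p * v x)); last first.
  by apply/eqP; rewrite eq_complex /=; apply/andP; split; apply/eqP; ring.
exact: has_derivative_complex.
Qed.

Lemma cexp_line_lipschitz s t : exists2 K : R, 0 < K & forall x y,
  s <= x <= t -> s <= y <= t ->
  normc (cexp (y%:C * (p +i* q)) - cexp (x%:C * (p +i* q))) <= K * `|y - x|.
Proof.
(* On the interval from [s] to [t] one has |x| <= |s| + |t|, so [M] bounds [expR (p * x)] and with
   it both [u] and [v]. *)
pose M := expR (`|p| * (`|s| + `|t|)).
have M0 : 0 < M by exact: expR_gt0.
pose K := (`|p| + `|q|) * M.
have expM x : s <= x <= t -> expR (p * x) <= M.
  move=> /andP[sx xt]; rewrite ler_expR (le_trans (ler_norm _))// normrM.
  by rewrite ler_wpM2l// ler_norml; have := ler_norm t; have := ler_norm (- s);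
    rewrite normrN; have := normr_ge0 t; have := normr_ge0 s; lra.
have uM x : s <= x <= t -> `|u x| <= M /\ `|v x| <= M.
  move=> xst; rewrite !normrM ger0_norm ?expR_ge0//.
  by split; rewrite -[leRHS]mulr1 ler_pM ?expM// ler_norml
    ?cos_le1 ?cos_geN1 ?sin_le1 ?sin_geN1.
have uK x : s <= x <= t -> `|p * u x - q * v x| <= K.
  move=> /uM[uxM vxM]; rewrite (le_trans (ler_normB _ _))// (normrM p) (normrM q) /K mulrDl.
  by apply: lerD; rewrite ler_wpM2l.
have vK x : s <= x <= t -> `|q * u x + p * v x| <= K.
  move=> /uM[uxM vxM]; rewrite (le_trans (ler_normD _ _))//.
  rewrite (normrM p) (normrM q) /K mulrDl [leLHS]addrC.
  by apply: lerD; rewrite ler_wpM2l.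
(* One [K] for each of the two coordinates; the 1 gives positivity when [p = q = 0]. *)
exists (K + K + 1); first by rewrite ltr_wpDl// addr_ge0 ?mulr_ge0 ?addr_ge0// ltW.
move=> x y xst yst; rewrite !cexp_lineE.
apply: le_trans (normc_le_ReIm _) _; rewrite /= !mulrDl mul1r.
have := is_derive_lipschitz d_u uK xst yst.
have := is_derive_lipschitz d_v vK xst yst.
have := normr_ge0 (y - x); lra.
Qed.
End CexpLine.

Lemma cexp_derivative (R : realType) (c : R[i]) (x : R) :
  has_derivative (fun y => cexp (y%:C * c)) x (c * cexp (x%:C * c)).
Proof. case: c => p q; exact: cexp_line_derivative. Qed.

Lemma cexp_lipschitz (R : realType) (c : R[i]) (s t : R) :
  exists2 K : R, 0 < K & forall x y, s <= x <= t -> s <= y <= t ->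
  normc (cexp (y%:C * c) - cexp (x%:C * c)) <= K * `|y - x|.
Proof. case: c => p q; exact: cexp_line_lipschitz. Qed.

(** * The equation [f' = c f] *)

Lemma lebesgue_ae_sub (R : realType) (P Q : R -> Prop) :
  (forall x, P x -> Q x) -> {ae (@lebesgue_measure R), forall x, P x} ->
  {ae (@lebesgue_measure R), forall x, Q x}.
Proof. by move=> PQ; apply: negligibleS => x nQ Px; apply/nQ/PQ. Qed.

Lemma lebesgue_ae_and (R : realType) (P Q : R -> Prop) :
  {ae (@lebesgue_measure R), forall x, P x} ->
  {ae (@lebesgue_measure R), forall x, Q x} ->
  {ae (@lebesgue_measure R), forall x, P x /\ Q x}.
Proof.
move=> aeP aeQ; apply: negligibleS (negligibleU aeP aeQ) => x nPQ.
by apply/not_andP.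
Qed.

Lemma cvg_complexM (R : realType) (T : Type) (F : set_system T)
    (FF : Filter F) (f g : T -> R[i]) (l m : R[i]) :
  f x @[x --> F] --> (l : R[i]^o) -> g x @[x --> F] --> (m : R[i]^o) ->
  f x * g x @[x --> F] --> (l * m : R[i]^o).
Proof.
move=> fl gm; have := @cvgM R[i] T F FF f g l m fl gm; exact: id.
Qed.

Lemma cvg_complexD (R : realType) (T : Type) (F : set_system T)
    (FF : Filter F) (f g : T -> R[i]) (l m : R[i]) :
  f x @[x --> F] --> (l : R[i]^o) -> g x @[x --> F] --> (m : R[i]^o) ->
  f x + g x @[x --> F] --> (l + m : R[i]^o).
Proof.
move=> fl gm; have := @cvgD R[i] R[i]^o T F FF f g l m fl gm; exact: id.
Qed.

Lemma cvg_complex_cst (R : realType) (T : Type) (F : set_system T)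
    (FF : Filter F) (l : R[i]) : (fun=> l) x @[x --> F] --> (l : R[i]^o).
Proof.
apply/cvg_normcP => eps e0; apply: nearW => x.
by rewrite subrr ComplexField.Normc.normc0.
Qed.

(** The derivative estimate with tolerance 1 gives |f(x + h) - f(x)| <= (|l| + 1) |h| for small
    [h]. *)
Lemma has_derivative_cvg (R : realType) (f : R -> R[i]) (x : R) (l : R[i]) :
  has_derivative f x l -> f (x + h) @[h --> 0^'] --> (f x : R[i]^o).
Proof.
move=> /has_derivativeP/(_ 1 ltr01)[d d0 Hd]; apply/cvg_normcP => eps e0.
have nl1 : 0 < normc l + 1 by rewrite ltr_wpDl// normc_nonneg.
near=> h.
have hd : `|h| < d by near: h; exact: dnbhs0_lt.
have he : `|h| < eps / (normc l + 1).
  by near: h; apply: dnbhs0_lt; rewrite divr_gt0.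
rewrite -(subrK (h%:C * l) (f (x + h) - f x)).
apply: le_lt_trans (normc_triangle _ _) _.
rewrite ComplexField.Normc.normcM normc_real.
have := Hd h hd; move: he; rewrite ltr_pdivlMr//; lra.
Unshelve. all: by end_near. Qed.

Lemma has_derivativeM (R : realType) (f g : R -> R[i]) (x : R) (l m : R[i]) :
  has_derivative f x l -> has_derivative g x m ->
  has_derivative (fun y => f y * g y) x (l * g x + f x * m).
Proof.
move=> fl gm; have gx := has_derivative_cvg gm.
rewrite /has_derivative.
(* Adding and subtracting [f x * g (x + h)] splits the quotient. *)
rewrite (_ : (fun _ => _) = fun h => (h^-1)%:C * (f (x + h) - f x) * g (x + h) +
  f x * ((h^-1)%:C * (g (x + h) - g x))); last first.
  apply/funext => h; rewrite !mulrBr mulrBl !mulrA (mulrC (f x)) addrA subrK.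
  by [].
have FF : Filter (0^' : set_system R) by exact: _.
have fx := @cvg_complex_cst R R _ FF (f x).
exact: (cvg_complexD FF (cvg_complexM FF fl gx) (cvg_complexM FF fx gm)).
Qed.

Lemma lipschitz_abs_continuous (R : realType) (J : set R) (f : R -> R[i])
    (K : R) :
  0 < K -> (forall x y, J x -> J y -> normc (f y - f x) <= K * `|y - x|) ->
  abs_continuous_on J f.
Proof.
move=> K0 fK eps e0; exists (eps / K); first exact: divr_gt0.
move=> n s t stJ _; rewrite ltr_pdivlMr// => /(le_lt_trans _); apply.
rewrite mulr_suml; apply: ler_sum => k _; have [st J_st] := stJ k.
rewrite mulrC -[X in K * X]ger0_norm ?subr_ge0//; apply: fK; apply: J_st;
  by rewrite /= in_itv /= lexx ?st.
Qed.

Lemma abs_continuous_unif (R : realType) (s t : R) (f : R -> R[i]) :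
  abs_continuous_on `[s, t]%classic f ->
  forall eps, 0 < eps -> exists2 d, 0 < d & forall x y,
    s <= x -> x <= y -> y <= t -> y - x < d -> normc (f y - f x) < eps.
Proof.
move=> fst eps e0; have [d d0 Hd] := fst _ e0; exists d => // x y sx xy yt yxd.
have := Hd 1%N (fun=> x) (fun=> y); rewrite !big_ord1; apply => //.
  move=> _; split=> // z /=; rewrite !in_itv /= => /andP[xz zy].
  by rewrite (le_trans sx xz) (le_trans zy yt).
by move=> i j _ _ _; rewrite (ord1 i) (ord1 j).
Qed.

(** Values at points closer than [d] differ by less than 1, so each step of length [d / 2] away from
    [s] raises the bound by 1, and finitely many steps cover the interval. *)
Lemma abs_continuous_bounded (R : realType) (s t : R) (f : R -> R[i]) :
  abs_continuous_on `[s, t]%classic f ->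
  exists2 N : R, 0 < N & forall x, s <= x <= t -> normc (f x) <= N.
Proof.
move=> /abs_continuous_unif/(_ 1 ltr01)[d d0 Hd].
have H n x : s <= x <= t -> x - s <= n%:R * (d / 2) ->
    normc (f x) <= normc (f s) + n%:R.
  elim: n x => [|n IH] x /andP[sx xt].
    rewrite mul0r subr_le0 addr0 => xs.
    by rewrite (_ : x = s)//; apply/eqP; rewrite eq_le xs sx.
  rewrite -natr1 mulrDl mul1r => xn.
  (* The preceding point is cut off at [s] so that it stays in the interval. *)
  rewrite -(subrK (f (Num.max s (x - d / 2))) (f x)).
  apply: le_trans (normc_triangle _ _) _; rewrite [leRHS]addrA [leLHS]addrC lerD//.
    apply: IH; rewrite ?le_max ?lexx//= ?ge_max; first by apply/andP; split; lra.
    have : 0 <= n%:R * (d / 2) by rewrite mulr_ge0//; lra.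
    by case: (leP s (x - d / 2)) => ?; lra.
  by apply/ltW/Hd => //; case: (leP s (x - d / 2)) => ?; lra.
pose n := (Num.truncn ((t - s) / (d / 2))).+1.
exists (normc (f s) + n%:R); first by rewrite ltr_wpDl// normc_nonneg.
move=> x /andP[sx xt]; apply: H; first by rewrite sx.
apply: (@le_trans _ _ (t - s)); first by rewrite lerD2r.
by rewrite ltW// -ltr_pdivrMr ?divr_gt0// /n truncnS_gt.
Qed.

(** The increment of the product is [(f v - f u) * g v + f u * (g v - g u)]: the first term is small
    by absolute continuity of [f], the second is at most a multiple of the length. Both need the
    bounds [M] and [N]. *)
Lemma abs_continuousM (R : realType) (s t K : R) (f g : R -> R[i]) :
  0 < K -> s <= t -> abs_continuous_on `[s, t]%classic f ->
  (forall x y, s <= x <= t -> s <= y <= t ->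
    normc (g y - g x) <= K * `|y - x|) ->
  abs_continuous_on `[s, t]%classic (fun x => f x * g x).
Proof.
move=> K0 st fst gK; have [N N0 fN] := abs_continuous_bounded fst.
pose M := normc (g s) + K * (t - s) + 1.
have M0 : 0 < M by rewrite ltr_wpDl// addr_ge0 ?normc_nonneg// mulr_ge0 ?subr_ge0// ltW.
have gM x : s <= x <= t -> normc (g x) <= M.
  move=> xst; rewrite -(subrK (g s) (g x)).
  apply: le_trans (normc_triangle _ _) _.
  have := gK s x; rewrite lexx st => /(_ isT xst); case/andP: xst => sx xt.
  rewrite ger0_norm ?subr_ge0// => H.
  have : K * (x - s) <= K * (t - s) by rewrite ler_pM2l// lerD2r.
  rewrite /M; lra.
move=> eps e0; have e2 : 0 < eps / (2 * M) by rewrite divr_gt0// mulr_gt0.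
have [d d0 Hd] := fst _ e2.
(* Total length below [d] keeps the first sum below [eps / 2]; the other bound does the same for the
   second. *)
exists (Num.min d (eps / (2 * (K * N)))).
  by rewrite lt_min d0 divr_gt0// !mulr_gt0.
move=> n u v uv tr; rewrite lt_min => /andP[uvd].
rewrite ltr_pdivlMr ?mulr_gt0// => uve.
have {}Hd := Hd n u v uv tr uvd.
have uk k : s <= u k <= t.
  have [ukvk /(_ (u k))/=] := uv k; rewrite !in_itv /= lexx ukvk; exact.
have vk k : s <= v k <= t.
  have [ukvk /(_ (v k))/=] := uv k; rewrite !in_itv /= lexx ukvk; exact.
apply: (@le_lt_trans _ _ (\sum_(k < n) (M * normc (f (v k) - f (u k)) +
    (K * N) * (v k - u k)))).
  apply: ler_sum => k _.
  have -> : f (v k) * g (v k) - f (u k) * g (u k) =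
      (f (v k) - f (u k)) * g (v k) + f (u k) * (g (v k) - g (u k)).
    by rewrite mulrBl mulrBr addrA subrK.
  apply: le_trans (normc_triangle _ _) _; rewrite !ComplexField.Normc.normcM.
  apply: lerD; first by rewrite mulrC ler_wpM2r ?normc_nonneg ?gM.
  rewrite mulrAC mulrC; apply: ler_pM; rewrite ?normc_nonneg ?fN//.
  by rewrite -[X in K * X]ger0_norm ?subr_ge0 ?(uv k).1// gK.
rewrite big_split /= -!mulr_sumr.
have : M * (\sum_(k < n) normc (f (v k) - f (u k))) < M * (eps / (2 * M)).
  by rewrite ltr_pM2l.
have -> : M * (eps / (2 * M)) = eps / 2 by field; rewrite gt_eqF.
lra.
Qed.

(** Integrating factor: [F x = f x * cexp (x%:C * - c)] is absolutely continuous on compact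
    subintervals with derivative zero almost everywhere, hence constant on [J]. *)
Lemma ode_solution (R : realType) (J : interval R) (c : R[i]) (f : R -> R[i]) :
  abs_continuous_on [set` J] f ->
  {ae (@lebesgue_measure R),
    forall x, [set` J] x -> has_derivative f x (c * f x)} ->
  exists C : R[i], forall x, x \in J -> f x = C * cexp (x%:C * c).
Proof.
move=> fJ df.
pose g x := cexp (x%:C * - c); pose F x := f x * g x.
have FJ x y : x \in J -> y \in J -> x <= y -> F y = F x.
  move=> xJ yJ xy.
  have xyJ : `[x, y]%classic `<=` [set` J].
    by move=> z /=; rewrite in_itv /=; exact: (interval_is_interval xJ yJ).
  have fxy := abs_continuous_on_subset xyJ fJ.
  have [K K0 gK] := cexp_lipschitz (- c) x y.
  apply: abs_continuous_derivative0 => //; first exact: abs_continuousM K0 xy fxy gK.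
  apply: lebesgue_ae_sub df => z dfz /xyJ /dfz fz.
  have := has_derivativeM fz (@cexp_derivative R (- c) z); rewrite -/(g z).
  rewrite (_ : _ + _ = 0)//.
  by rewrite mulNr mulrN mulrA (mulrC c) subrr.
(* The constant is the value of [F] at some point of [J]; an empty [J] is served by 0. *)
have [[x0 x0J]|J0] := pselect (exists x, x \in J); last first.
  by exists 0 => x xJ; exfalso; apply: J0; exists x.
exists (F x0) => x xJ.
have -> : F x0 = F x by have [?|/ltW ?] := leP x x0; [|symmetry]; apply: FJ.
by rewrite /F /g mulrN cexpN divfK// cexp_neq0.
Qed.

(** * The matrix [B] and the function [D] *)

Lemma eD (R : realType) (x y : R) : e (x + y) = e x * e y.
Proof. by rewrite !e_cexp -cexpD rmorphD mulrDl. Qed.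

Lemma eN (R : realType) (x : R) : e (- x) = (e x)^-1.
Proof. by rewrite !e_cexp -cexpN rmorphN mulNr. Qed.

Lemma e_neq0 (R : realType) (x : R) : e x != 0.
Proof. by rewrite e_cexp cexp_neq0. Qed.

Lemma normc_e (R : realType) (x : R) : normc (e x) = 1.
Proof. by rewrite /e /= cos2Dsin2 sqrtr1. Qed.

Lemma det_mx22 (R : comPzRingType) (M : 'M[R]_2) :
  \det M = M 0 0 * M 1 1 - M 0 1 * M 1 0.
Proof.
rewrite (expand_det_row _ 0) !big_ord_recl big_ord0 /cofactor !det_mx11 !mxE /=.
rewrite expr0 expr1 mul1r addr0 mulN1r mulrN.
by congr (M _ _ * M _ _ - M _ _ * M _ _); apply/val_inj.
Qed.

Section Algebra.
Variables (R : realType) (a b : R[i]).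
Hypothesis hab : `|a| ^+ 2 + `|b| ^+ 2 = 1.

Lemma mul_conjc_add : a * a^*%C + b * b^*%C = 1.
Proof. by rewrite -!sqr_normc. Qed.

Lemma mx_B_unitary : mx_B a b \is unitarymx.
Proof.
have ab := mul_conjc_add; apply/unitarymxP/matrixP => i j.
rewrite !mxE !big_ord_recl big_ord0 !mxE /=.
have conjE (x : R[i]) : Num.conj x = conjc x by [].
have conjN (x : R[i]) : conjc (- x) = - conjc x by exact: rmorphN.
case: i => [[|[|[|//]]] ?]; case: j => [[|[|[|//]]] ?] /=;
  rewrite ?conjE ?conjN ?conjc0 ?conjc1 ?conjcK -?ab ?mulr1n ?mulr0n; try ring.
by rewrite ab mul1r !mul0r !addr0.
Qed.

(** The diagonal and off-diagonal products carry the same exponential factor, whose total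
    coefficient is |a|^2 + |b|^2 = 1. *)
Lemma det_mx_B' (alpha1 beta2 alpha2 beta3 lambda : R) :
  \det (1%:M - mx_B' alpha1 beta2 alpha2 beta3 a b lambda) =
  D lambda a (beta2 - alpha1) (beta3 - alpha2).
Proof.
have ab := mul_conjc_add.
rewrite det_mx22 !mxE /= /D /e_ !mulrDr !eD.
have conjE (x : R[i]) : Num.conj x = conjc x by [].
rewrite ?conjE !mulr1n !mulr0n.
set u1 := e (lambda * beta2); set u2 := e (lambda * - alpha1).
set u3 := e (lambda * beta3); set u4 := e (lambda * - alpha2).
transitivity (1 - a * (u1 * u2) - a^*%C * (u3 * u4) +
  (a * a^*%C + b * b^*%C) * (u1 * u2 * (u3 * u4))); first by ring.
by rewrite ab mul1r; ring.
Qed.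

(** [D] is affine in [e (lambda * L2)]. Solving for it divides by a difference that is nonzero
    because [w < 1] while the exponential has modulus 1. *)
Lemma D_eq0_div (w phi0 : R) : 0 < w < 1 -> a = w%:C * e phi0 ->
  forall lambda L1 L2 : R, D lambda a L1 L2 = 0 <->
    e (lambda * L2 - phi0) =
      (1 - w%:C * e (lambda * L1 + phi0)) /
      (w%:C - e (lambda * L1 + phi0)).
Proof.
move=> /andP[w0 w1] aE lambda L1 L2.
have conjE (x : R[i]) : Num.conj x = conjc x by [].
have aC : a^*%C = w%:C * (e phi0)^-1.
  rewrite aE -eN /e mulrN cosN sinN; apply/eqP; rewrite eq_complex /=.
  by apply/andP; split; apply/eqP; ring.
rewrite /D /e_ ?conjE aC aE mulrDr !eD eN.
have p0 := e_neq0 phi0.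
have den0 : w%:C - e (lambda * L1) * e phi0 != 0.
  apply/eqP => /eqP; rewrite subr_eq0 => /eqP /(congr1 (@ComplexField.Normc.normc R)).
  rewrite ComplexField.Normc.normcM !normc_e mulr1 normc_real ger0_norm ?(ltW w0)//.
  by move=> w1'; rewrite w1' ltxx in w1.
set u := e (lambda * L1) in den0 *; set v := e (lambda * L2); set p := e phi0 in p0 den0 *.
have -> : (1 + u * v - w%:C * p * u - w%:C * p^-1 * v = 0) <->
   v * p^-1 * (w%:C - u * p) = 1 - w%:C * (u * p).
  split=> [H|H].
    apply/eqP; rewrite -subr_eq0; apply/eqP; rewrite -[RHS]oppr0 -H; field.
    exact: p0.
  apply/eqP; rewrite -oppr_eq0; apply/eqP; move/eqP: H; rewrite -subr_eq0 => /eqP <-.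
  by field.
split=> [<-|->]; by rewrite ?mulfK// divfK.
Qed.
End Algebra.

(** * The boundary conditions as linear algebra *)

Section BoundaryTransfer.
Variables (R : realType) (a b : R[i]).
Hypothesis hab : `|a| ^+ 2 + `|b| ^+ 2 = 1.

(** The matrix decouples: its third row links the two half-lines, the other rows form a 2x2 system
    for the bounded intervals. *)
Lemma mx_B_mulP (p1 p2 p3 q1 q2 q3 : R[i]) :
  mx_B a b *m col3 p1 p2 p3 = col3 q1 q2 q3 <->
  [/\ a * p2 + b * p3 = q1, - b^*%C * p2 + a^*%C * p3 = q2 & p1 = q3].
Proof.
have E i : (mx_B a b *m col3 p1 p2 p3) i 0 =
    nth 0 [:: a * p2 + b * p3; - b^*%C * p2 + a^*%C * p3; p1] i.
  rewrite !mxE !big_ord_recl big_ord0 !mxE.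
  case: i => [[|[|[|//]]] ?] /=; rewrite ?mul0r ?mul1r ?add0r ?addr0//.
split=> [H|[<- <- <-]].
  by have := E 0; have := E 1; have := E (inord 2);
    rewrite H !mxE /= inordK// => -> -> ->.
apply/matrixP => i j; rewrite (ord1 j) E mxE.
by case: i => [[|[|[|//]]] ?].
Qed.

Lemma sqr_normcE (x : R[i]) : (normc x ^+ 2)%:C = x * x^*%C.
Proof. by rewrite rmorphXn /= -sqr_normc. Qed.

(** This is unitarity of the 2x2 block: the mixed terms cancel and |a|^2 + |b|^2 factors out. *)
Lemma transfer_isometry (x y : R[i]) :
  normc (a * x + b * y) ^+ 2 + normc (- b^*%C * x + a^*%C * y) ^+ 2 =
  normc x ^+ 2 + normc y ^+ 2.
Proof.
have ab := mul_conjc_add hab.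
apply: (@complexI R); rewrite !rmorphD /= !sqr_normcE.
have conjD (u v : R[i]) : conjc (u + v) = conjc u + conjc v by exact: rmorphD.
have conjM (u v : R[i]) : conjc (u * v) = conjc u * conjc v by exact: rmorphM.
have conjN (u : R[i]) : conjc (- u) = - conjc u by exact: rmorphN.
rewrite !(conjD, conjM, conjN, conjcK).
transitivity ((a * a^*%C + b * b^*%C) * (x * x^*%C + y * y^*%C)); first by ring.
by rewrite ab mul1r.
Qed.

(** Multiplying the homogeneous 2x2 system by its adjugate shows that the determinant annihilates
    both [x] and [y]. *)
Lemma transfer_fixed_char (E1 E2 x y : R[i]) :
  a * (E1 * x) + b * (E2 * y) = x ->
  - b^*%C * (E1 * x) + a^*%C * (E2 * y) = y ->
  (x != 0) || (y != 0) -> 1 + E1 * E2 - a * E1 - a^*%C * E2 = 0.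
Proof.
have ab := mul_conjc_add hab => Hx Hy xy0.
have DE : 1 + E1 * E2 - a * E1 - a^*%C * E2 =
    1 + (a * a^*%C + b * b^*%C) * (E1 * E2) - a * E1 - a^*%C * E2.
  by rewrite ab mul1r.
move/eqP: Hx; rewrite eq_sym -subr_eq0 => /eqP Hx.
move/eqP: Hy; rewrite eq_sym -subr_eq0 => /eqP Hy.
have Dx : (1 + E1 * E2 - a * E1 - a^*%C * E2) * x = 0.
  transitivity ((1 - a^*%C * E2) * (x - (a * (E1 * x) + b * (E2 * y))) +
    b * E2 * (y - (- b^*%C * (E1 * x) + a^*%C * (E2 * y)))).
    by rewrite DE; ring.
  by rewrite Hx Hy !mulr0 addr0.
have Dy : (1 + E1 * E2 - a * E1 - a^*%C * E2) * y = 0.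
  transitivity ((1 - a * E1) * (y - (- b^*%C * (E1 * x) + a^*%C * (E2 * y))) -
    b^*%C * E1 * (x - (a * (E1 * x) + b * (E2 * y)))).
    by rewrite DE; ring.
  by rewrite Hx Hy !mulr0 subr0.
by case/orP: xy0 => ne0; apply: (mulIf ne0); rewrite mul0r.
Qed.

(** The vector is the second column of the adjugate: the first equation is an identity, and the
    residual of the second is the determinant. *)
Lemma transfer_fixed_vector (E1 E2 : R[i]) :
  1 + E1 * E2 - a * E1 - a^*%C * E2 = 0 ->
  let x := b * E2 in let y := 1 - a * E1 in
  a * (E1 * x) + b * (E2 * y) = x /\
  - b^*%C * (E1 * x) + a^*%C * (E2 * y) = y.
Proof.
have ab := mul_conjc_add hab => D0 x y; split; first by rewrite /x /y; ring.
apply/eqP; rewrite eq_sym -subr_eq0; apply/eqP.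
transitivity (1 + (a * a^*%C + b * b^*%C) * (E1 * E2) - a * E1 - a^*%C * E2).
  by rewrite /x /y; ring.
by rewrite ab mul1r.
Qed.

End BoundaryTransfer.

(** * Uniqueness of limits and local comparison of functions *)

Lemma cvg_complex_unique (R : realType) (F : set_system R) (FF : ProperFilter F)
    (f : R -> R[i]) (l m : R[i]) :
  f x @[x --> F] --> (l : R[i]^o) -> f x @[x --> F] --> (m : R[i]^o) -> l = m.
Proof.
move=> fl fm.
have := @cvg_unique R[i]^o (@norm_hausdorff R[i] R[i]^o) _ _ l m fl fm; exact.
Qed.

Lemma has_derivative_continuous (R : realType) (f : R -> R[i]) (x : R)
    (l : R[i]) :
  has_derivative f x l -> f y @[y --> x] --> (f x : R[i]^o).
Proof.
move=> /has_derivative_cvg/cvg_normcP H; apply/cvg_normcP => eps e0.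
have := H _ e0; rewrite near_withinE => /nbhs_ballP[d /= d0 Hd].
apply/nbhs_ballP; exists d => //= y; rewrite /ball /= => xyd.
have [->|yx] := eqVneq y x; first by rewrite subrr ComplexField.Normc.normc0.
have := Hd (y - x); rewrite /ball /= sub0r normrN distrC subr_eq0.
by move=> /(_ xyd yx); rewrite (addrC x) subrK.
Qed.

(** Meant for one-sided limits, where [f] agrees with the continuous [h] only on the side seen by
    [F]. *)
Lemma cvg_near_eq (R : realType) (F : set_system R) (FF : Filter F) (x : R)
    (f h : R -> R[i]) :
  F --> x -> (\forall y \near F, f y = h y) ->
  h y @[y --> x] --> (h x : R[i]^o) -> f y @[y --> F] --> (h x : R[i]^o).
Proof.
move=> Fx fh /cvg_normcP H; apply/cvg_normcP => eps e0.
have := Fx _ (H _ e0); rewrite /= => HF.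
by apply: filterS2 fh HF => y ->.
Qed.

Lemma has_derivative_near (R : realType) (f h : R -> R[i]) (x : R) (l : R[i]) :
  (\forall y \near x, f y = h y) -> has_derivative h x l ->
  has_derivative f x l.
Proof.
move=> /nbhs_ballP[r /= r0 Hr] /has_derivativeP H; apply/has_derivativeP => eps e0.
have [d d0 Hd] := H _ e0; exists (Num.min d r); first by rewrite lt_min d0.
move=> k; rewrite lt_min => /andP[kd kr].
rewrite !Hr ?Hd//; first exact: ballxx.
by rewrite /ball /= opprD addrA subrr sub0r normrN.
Qed.

Lemma cexp_scaled_derivative (R : realType) (C c : R[i]) (x : R) :
  has_derivative (fun y => C * cexp (y%:C * c)) x (c * (C * cexp (x%:C * c))).
Proof.
have FF : Filter (0^' : set_system R) by exact: _.
have H := @cvg_complexM R R _ FF _ _ _ _ (@cvg_complex_cst R R _ FF C)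
  (@cexp_derivative R c x).
rewrite /has_derivative mulrCA.
rewrite (_ : (fun _ => _) = fun h => C * ((h^-1)%:C *
  (cexp ((x + h)%:C * c) - cexp (x%:C * c)))); first exact: H.
by apply/funext => h; rewrite -mulrBr mulrCA.
Qed.

(** * Square integrability *)

Lemma sqr_normc_ReIm (R : realType) (x : R[i]) :
  normc x ^+ 2 = complex.Re x ^+ 2 + complex.Im x ^+ 2.
Proof. by case: x => u v; rewrite /= sqr_sqrtr// addr_ge0 ?sqr_ge0. Qed.

Lemma measurable_sqr_normc (R : realType) (E : set R) (f : R -> R[i]) :
  measurable_fun E (fun x => complex.Re (f x)) ->
  measurable_fun E (fun x => complex.Im (f x)) ->
  measurable_fun E (fun x => (normc (f x) ^+ 2)%:E).
Proof.
move=> mRe mIm; apply/measurable_EFinP.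
rewrite (_ : (fun _ => _) =
  fun x => complex.Re (f x) ^+ 2 + complex.Im (f x) ^+ 2).
  by apply: measurable_funD; apply: measurable_funX.
by apply/funext => x; rewrite sqr_normc_ReIm.
Qed.

(** Chebyshev's inequality: [k ^+ 2] times the measure of [K] is at most the integral of |f|^2. It
    will be contradicted on half-lines. *)
Lemma L2_lower_bound (R : realType) (E K : set R) (f : R -> R[i]) (k : R) :
  measurable E -> measurable K -> K `<=` E -> L2 E f -> 0 < k ->
  (forall x, K x -> k <= normc (f x)) -> (lebesgue_measure K < +oo)%E.
Proof.
move=> mE mK KE [mRe mIm fE] k0 kf.
have mf := measurable_sqr_normc mRe mIm.
have k20 : 0 < k ^+ 2 by rewrite exprn_gt0.
have : ((k ^+ 2)%:E * lebesgue_measure K < +oo)%E.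
  apply: le_lt_trans fE; rewrite -integral_cst//.
  apply: (@le_trans _ _ (\int[lebesgue_measure]_(x in K) (normc (f x) ^+ 2)%:E)%E).
    apply: ge0_le_integral => //.
    - by move=> x _; rewrite lee_fin ltW.
    - exact: measurable_funS mf.
    - by move=> x Kx; rewrite lee_fin lerXn2r ?nnegrE ?normc_nonneg ?kf// ltW.
  by apply: ge0_subset_integral => // x _; rewrite lee_fin sqr_ge0.
case muK : (lebesgue_measure K) => [r| |]; rewrite ?ltry ?ltNyr//.
by rewrite gt0_muley// lte_fin.
Qed.

(** Integrate |f|^2 <= M^2 1_K; the indicator allows [E] to have infinite measure. *)
Lemma L2_upper_bound (R : realType) (E K : set R) (f : R -> R[i]) (M : R) :
  measurable E -> measurable K -> (lebesgue_measure K < +oo)%E ->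
  measurable_fun E (fun x => complex.Re (f x)) ->
  measurable_fun E (fun x => complex.Im (f x)) ->
  (forall x, E x -> normc (f x) <= M * \1_K x) -> L2 E f.
Proof.
move=> mE mK muK mRe mIm fM; split => //.
have mf := measurable_sqr_normc mRe mIm.
apply: (@le_lt_trans _ _
  (\int[lebesgue_measure]_(x in E) ((M ^+ 2)%:E * (\1_K x)%:E))%E).
  apply: ge0_le_integral => //.
  - by move=> x _; rewrite lee_fin sqr_ge0.
  - apply/measurable_EFinP; apply: measurable_funM => //; exact: measurable_indic.
  - move=> x Ex; rewrite -EFinM lee_fin.
    apply: (@le_trans _ _ ((M * \1_K x) ^+ 2)).
      have fMx := fM _ Ex; have f0 := normc_nonneg (f x).
      by rewrite lerXn2r ?nnegrE// (le_trans f0).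
    by rewrite indicE; case: (x \in K); rewrite /= ?mulr1 ?mulr0 ?expr0n.
have mK1 : measurable_fun E (fun x => (\1_K x)%:E : \bar R).
  by apply/measurable_EFinP; exact: measurable_indic.
have K0 x : E x -> (0 <= (\1_K x)%:E :> \bar R)%E by rewrite lee_fin.
rewrite ge0_integralZl_EFin ?sqr_ge0//.
rewrite integral_indic// lte_mul_pinfty ?lee_fin ?sqr_ge0//.
apply: le_lt_trans muK; apply: le_measure; rewrite ?inE//.
exact: measurableI.
Qed.

Lemma has_derivative_continuous_ReIm (R : realType) (f df : R -> R[i]) :
  (forall x, has_derivative f x (df x)) ->
  continuous (fun x => complex.Re (f x)) /\
  continuous (fun x => complex.Im (f x)).
Proof.
move=> fd; split=> x; apply/cvgrPdistC_lt => eps e0.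
  have /cvg_normcP/(_ _ e0) := has_derivative_continuous (fd x).
  by apply: filterS => y; apply: le_lt_trans; rewrite -raddfB; exact: le_Re_normc.
have /cvg_normcP/(_ _ e0) := has_derivative_continuous (fd x).
by apply: filterS => y; apply: le_lt_trans; rewrite -raddfB; exact: le_Im_normc.
Qed.

Lemma measurable_cexp_scaled (R : realType) (E : set R) (f : R -> R[i])
    (C c : R[i]) :
  (forall x, E x -> f x = C * cexp (x%:C * c)) -> measurable E ->
  measurable_fun E (fun x => complex.Re (f x)) /\
  measurable_fun E (fun x => complex.Im (f x)).
Proof.
move=> fE mE; have [cRe cIm] := has_derivative_continuous_ReIm
  (@cexp_scaled_derivative R C c).
split; [move: cRe|move: cIm] => /continuous_measurable_fun/measurable_funTS.
  by move=> /(_ E); apply: eq_measurable_fun => x; rewrite inE => /fE ->.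
by move=> /(_ E); apply: eq_measurable_fun => x; rewrite inE => /fE ->.
Qed.

Lemma normc_cexp_scaled (R : realType) (C c : R[i]) (x : R) :
  normc (C * cexp (x%:C * c)) = normc C * expR (x * complex.Re c).
Proof.
rewrite ComplexField.Normc.normcM normc_cexp.
by case: c => p q /=; rewrite mul0r subr0.
Qed.

Lemma cexp_scaled_lipschitz (R : realType) (C c : R[i]) (s t : R) :
  exists2 K : R, 0 < K & forall x y, s <= x <= t -> s <= y <= t ->
  normc (C * cexp (y%:C * c) - C * cexp (x%:C * c)) <= K * `|y - x|.
Proof.
have [K K0 HK] := cexp_lipschitz c s t.
exists ((normc C + 1) * K); first by rewrite mulr_gt0// ltr_wpDl// normc_nonneg.
move=> x y xst yst; rewrite -mulrBr ComplexField.Normc.normcM -mulrA.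
apply: ler_pM; rewrite ?normc_nonneg ?HK//.
by rewrite lerDl.
Qed.

(** * Eigenvalues and eigenfunctions *)

Lemma measure_ray_left (R : realType) (x : R) :
  lebesgue_measure (`]-oo, x[%classic : set R) = +oo%E.
Proof. by rewrite lebesgue_measure_itv /= ltNyr. Qed.

Lemma measure_ray_right (R : realType) (x : R) :
  lebesgue_measure (`]x, +oo[%classic : set R) = +oo%E.
Proof. by rewrite lebesgue_measure_itv /= ltry. Qed.

(** The equation reads [(r1 - 1) * x + (r2 - 1) * y = 0], a sum of two terms of the same sign. *)
Lemma expanding_isometry0 (R : realType) (r1 r2 x y : R) :
  (1 < r1 /\ 1 < r2) \/ (r1 < 1 /\ r2 < 1) -> 0 <= x -> 0 <= y ->
  r1 * x + r2 * y = x + y -> x = 0 /\ y = 0.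
Proof. by case=> -[? ?] x0 y0 H; split; nra. Qed.

(** * Functions equal to a scaled exponential on an interval *)

Section Limits.
Variables (R : realType) (f : R -> R[i]) (C c : R[i]).

Lemma cexp_scaled_left_limit (s t : R) : s < t ->
  (forall x, s < x < t -> f x = C * cexp (x%:C * c)) ->
  f x @[x --> t^'-] --> (C * cexp (t%:C * c) : R[i]^o).
Proof.
move=> st fE.
apply: (@cvg_near_eq R _ _ t f (fun x => C * cexp (x%:C * c))).
- exact: cvg_within.
- near=> x; apply: fE; apply/andP; split; near: x.
    exact: nbhs_left_gt.
  exact: nbhs_left_lt.
- exact: (has_derivative_continuous (@cexp_scaled_derivative R C c t)).
Unshelve. all: by end_near. Qed.

Lemma cexp_scaled_right_limit (s t : R) : s < t ->
  (forall x, s < x < t -> f x = C * cexp (x%:C * c)) ->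
  f x @[x --> s^'+] --> (C * cexp (s%:C * c) : R[i]^o).
Proof.
move=> st fE.
apply: (@cvg_near_eq R _ _ s f (fun x => C * cexp (x%:C * c))).
- exact: cvg_within.
- near=> x; apply: fE; apply/andP; split; near: x.
    exact: nbhs_right_gt.
  exact: nbhs_right_lt.
- exact: (has_derivative_continuous (@cexp_scaled_derivative R C c s)).
Unshelve. all: by end_near. Qed.

Lemma cexp_scaled_open_derivative (J : set R) : open J ->
  (forall x, J x -> f x = C * cexp (x%:C * c)) ->
  forall x, J x -> has_derivative f x (c * f x).
Proof.
move=> oJ fE x Jx; rewrite fE//.
apply: has_derivative_near (@cexp_scaled_derivative R C c x).
have : nbhs x J by exact: open_nbhs_nbhs.
by apply: filterS => y /fE.
Qed.

Lemma cexp_scaled_abs_continuous (s t : R) :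
  (forall x, s < x < t -> f x = C * cexp (x%:C * c)) ->
  abs_continuous_on `]s, t[%classic f.
Proof.
move=> fE; have [K K0 HK] := cexp_scaled_lipschitz C c s t.
apply: (lipschitz_abs_continuous K0) => x y /=.
rewrite !in_itv /= => xst yst; rewrite !fE//; apply: HK.
  by case/andP: xst => /ltW-> /ltW->.
by case/andP: yst => /ltW-> /ltW->.
Qed.

Lemma cst0_abs_continuous (J : set R) :
  (forall x, J x -> f x = 0) -> abs_continuous_on J f.
Proof.
move=> fE; apply: (lipschitz_abs_continuous ltr01) => x y /fE-> /fE->.
by rewrite subrr ComplexField.Normc.normc0 mul1r.
Qed.
End Limits.

Section Spectrum.
Variables (R : realType) (beta1 alpha1 beta2 alpha2 beta3 alpha3 : R).
Hypotheses (h1 : beta1 < alpha1) (h2 : alpha1 < beta2) (h3 : beta2 < alpha2)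
  (h4 : alpha2 < beta3) (h5 : beta3 < alpha3).
Variables (a b : R[i]).

Let Om := Omega beta1 alpha1 beta2 alpha2 beta3 alpha3.
Let I0 : set R := `]-oo, beta1[%classic.
Let I1 : set R := `]alpha1, beta2[%classic.
Let I2 : set R := `]alpha2, beta3[%classic.
Let I3 : set R := `]alpha3, +oo[%classic.

Let I0Om : I0 `<=` Om. Proof. by move=> x ?; left; left; left. Qed.
Let I1Om : I1 `<=` Om. Proof. by move=> x ?; left; left; right. Qed.
Let I2Om : I2 `<=` Om. Proof. by move=> x ?; left; right. Qed.
Let I3Om : I3 `<=` Om. Proof. by move=> x ?; right. Qed.

Let measurable_Om : measurable Om.
Proof. by repeat apply: measurableU; exact: measurable_itv. Qed.

Let measurable_Om_fun (h : R -> R) :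
  measurable_fun I0 h -> measurable_fun I1 h -> measurable_fun I2 h ->
  measurable_fun I3 h -> measurable_fun Om h.
Proof.
move=> m0 m1 m2 m3; rewrite /Om /Omega.
by do 3?[apply/measurable_funU;
  [by repeat apply: measurableU; exact: measurable_itv|exact: measurable_itv|
   split=> //]].
Qed.

(** With this factor the eigenvalue equation at [z] becomes [f' = tau * z * f]. *)
Let tau : R[i] := ('i * (2 * pi)%:C)%R.

Let tau_neq0 : tau != 0.
Proof.
rewrite /tau mulf_neq0 ?neq0Ci//; apply/eqP => /complexI/eqP.
by rewrite mulf_eq0 pnatr_eq0/= gt_eqF// pi_gt0.
Qed.

Let Re_tau (z : R[i]) : complex.Re (tau * z) = - (2 * pi) * complex.Im z.
Proof. by rewrite /tau -complexiE; case: z => x y /=; ring. Qed.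

Let cexp_tau (lambda L : R) : cexp (L%:C * (tau * lambda%:C)) = e_ lambda L.
Proof. by rewrite /e_ e_cexp rmorphM /= -/tau; congr cexp; ring. Qed.

Let D_cexp (lambda L1 L2 : R) : D lambda a L1 L2 =
  1 + e_ lambda L1 * e_ lambda L2 - a * e_ lambda L1 - a^*%C * e_ lambda L2.
Proof. by rewrite /D /e_ mulrDr eD. Qed.

Lemma point_spectrum_D (z : R[i]) : `|a| ^+ 2 + `|b| ^+ 2 = 1 ->
  point_spectrum beta1 alpha1 beta2 alpha2 beta3 alpha3 (mx_B a b) z ->
  exists2 lambda : R, D lambda a (beta2 - alpha1) (beta3 - alpha2) = 0 &
    lambda%:C = z.
Proof.
move=> hab [f [g [[df [fL2 [ac0 ac1 ac2 ac3] [dfae dfL2] bc] gE] fn0 gz]]].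
pose c := tau * z.
have df_c : {ae (@lebesgue_measure R),
    forall x, Om x -> has_derivative f x (c * f x)}.
  apply: lebesgue_ae_sub (lebesgue_ae_and dfae gz) => x [dfx gx] Omx.
  have <- : df x = c * f x; last exact: dfx.
  by rewrite /c -mulrA -gx// gE mulrA mulfV// mul1r.
have ode (J : interval R) : [set` J] `<=` Om -> abs_continuous_on [set` J] f ->
    exists C : R[i], forall x, x \in J -> f x = C * cexp (x%:C * c).
  move=> JOm acJ; apply: ode_solution acJ _.
  by apply: lebesgue_ae_sub df_c => x H /JOm.
have [C0 f0] := ode _ I0Om ac0.
have [C1 f1] := ode _ I1Om ac1.
have [C2 f2] := ode _ I2Om ac2.
have [C3 f3] := ode _ I3Om ac3.
(* If [Re c <= 0], then |f| stays above its limit at [beta1] on the whole left half-line, against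
   square integrability. The right half-line is symmetric. *)
have C0p : C0 != 0 -> 0 < complex.Re c.
  move=> C00; rewrite ltNge; apply/negP => p0.
  have k0 : 0 < normc C0 * expR (beta1 * complex.Re c).
    rewrite mulr_gt0 ?expR_gt0// lt_neqAle normc_nonneg andbT eq_sym.
    by apply: contraNN C00 => /eqP/ComplexField.Normc.eq0_normc->.
  suff : (lebesgue_measure I0 < +oo)%E by rewrite measure_ray_left ltxx.
  apply: (L2_lower_bound measurable_Om (measurable_itv _) I0Om fL2 k0) => x /=.
  rewrite in_itv /= => xb.
  rewrite f0 ?in_itv// normc_cexp_scaled ler_wpM2l ?normc_nonneg// ler_expR.
  by rewrite ler_wnM2r// ltW.
have C3p : C3 != 0 -> complex.Re c < 0.
  move=> C30; rewrite ltNge; apply/negP => p0.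
  have k0 : 0 < normc C3 * expR (alpha3 * complex.Re c).
    rewrite mulr_gt0 ?expR_gt0// lt_neqAle normc_nonneg andbT eq_sym.
    by apply: contraNN C30 => /eqP/ComplexField.Normc.eq0_normc->.
  suff : (lebesgue_measure I3 < +oo)%E by rewrite measure_ray_right ltxx.
  apply: (L2_lower_bound measurable_Om (measurable_itv _) I3Om fL2 k0) => x /=.
  rewrite in_itv /= andbT => xb.
  rewrite f3 ?in_itv/= ?andbT// normc_cexp_scaled ler_wpM2l ?normc_nonneg// ler_expR.
  by rewrite ler_wpM2r// ltW.
have [p1 [p2 [p3 [q1 [q2 [q3 [[fp1 fp2 fp3] [[fq1 fq2 fq3] Bpq]]]]]]]] := bc.
(* The limits in the boundary condition are the exponential formulas at the end points; [beta1 - 1]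
   only selects a bounded piece of the half-line. *)
have p1E : p1 = C0 * cexp (beta1%:C * c).
  apply: cvg_complex_unique fp1 _.
  apply: (@cexp_scaled_left_limit _ _ _ _ (beta1 - 1)); first by rewrite gtrBl.
  by move=> x /andP[_ xb]; apply: f0; rewrite in_itv.
have p2E : p2 = C1 * cexp (beta2%:C * c).
  apply: cvg_complex_unique fp2 _.
  by apply: cexp_scaled_left_limit h2 _ => x xb; apply: f1; rewrite in_itv.
have p3E : p3 = C2 * cexp (beta3%:C * c).
  apply: cvg_complex_unique fp3 _.
  by apply: cexp_scaled_left_limit h4 _ => x xb; apply: f2; rewrite in_itv.
have q1E : q1 = C1 * cexp (alpha1%:C * c).
  apply: cvg_complex_unique fq1 _.
  by apply: cexp_scaled_right_limit h2 _ => x xb; apply: f1; rewrite in_itv.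
have q2E : q2 = C2 * cexp (alpha2%:C * c).
  apply: cvg_complex_unique fq2 _.
  by apply: cexp_scaled_right_limit h4 _ => x xb; apply: f2; rewrite in_itv.
have q3E : q3 = C3 * cexp (alpha3%:C * c).
  apply: cvg_complex_unique fq3 _.
  apply: (@cexp_scaled_right_limit _ _ _ _ _ (alpha3 + 1)); first by rewrite ltrDl.
  by move=> x /andP[xa _]; apply: f3; rewrite in_itv /= xa.
move/mx_B_mulP: Bpq => [B1 B2 B3].
(* The third condition equates nonzero multiples of [C0] and [C3]. *)
have C03 : (C0 == 0) = (C3 == 0).
  have := congr1 (fun w => w == 0) B3.
  by rewrite p1E q3E !mulf_eq0 !(negPf (cexp_neq0 _)) !orbF.
have C00 : C0 = 0.
  apply/eqP/negPn/negP => C0n; have C3n : C3 != 0 by rewrite -C03.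
  by have := lt_trans (C0p C0n) (C3p C3n); rewrite ltxx.
have C30 : C3 = 0 by apply/eqP; rewrite -C03 C00.
(* [E1] and [E2] carry the left end value of each bounded interval to its right end value. *)
pose E1 := cexp ((beta2 - alpha1)%:C * c).
pose E2 := cexp ((beta3 - alpha2)%:C * c).
have p2E1 : p2 = E1 * q1.
  by rewrite p2E q1E [RHS]mulrCA /E1 -cexpD -mulrDl -rmorphD subrK.
have p3E2 : p3 = E2 * q2.
  by rewrite p3E q2E [RHS]mulrCA /E2 -cexpD -mulrDl -rmorphD subrK.
rewrite p2E1 p3E2 in B1 B2.
(* Otherwise all four constants vanish and [f] is zero on [Omega]. *)
have q0 : (q1 != 0) || (q2 != 0).
  rewrite -negb_and; apply/negP => /andP[].
  rewrite q1E q2E !mulf_eq0 !(negPf (cexp_neq0 _)) !orbF => /eqP C10 /eqP C20.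
  apply: fn0; apply: aeW => x [[[]|]|] Jx.
  - by rewrite f0// C00 mul0r.
  - by rewrite f1// C10 mul0r.
  - by rewrite f2// C20 mul0r.
  - by rewrite f3// C30 mul0r.
(* Squared moduli grow by exp(2 L Re c) along an interval of length L > 0, so for nonzero [Re c]
   both factors lie on the same side of 1, against the isometry. *)
have Re_c : complex.Re c = 0.
  have := transfer_isometry hab (E1 * q1) (E2 * q2); rewrite B1 B2.
  have normE L : normc (cexp (L%:C * c)) = expR (L * complex.Re c).
    by rewrite -[cexp _]mul1r normc_cexp_scaled ComplexField.Normc.normc1 mul1r.
  rewrite !ComplexField.Normc.normcM !exprMn !normE => /esym iso.
  apply/eqP/negPn/negP => Rc0.
  have L1 : 0 < beta2 - alpha1 by rewrite subr_gt0.
  have L2 : 0 < beta3 - alpha2 by rewrite subr_gt0.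
  have := expanding_isometry0 _ (sqr_ge0 _) (sqr_ge0 _) iso.
  case.
    move: Rc0; rewrite neq_lt => /orP[] Rc0; [right|left]; split;
      rewrite -?[ltRHS](expr1n _ 2) -?[ltLHS](expr1n _ 2).
    - by rewrite ltr_pXn2r ?nnegrE ?expR_ge0// expR_lt1 pmulr_rlt0.
    - by rewrite ltr_pXn2r ?nnegrE ?expR_ge0// expR_lt1 pmulr_rlt0.
    - by rewrite ltr_pXn2r ?nnegrE ?expR_ge0// expR_gt1 pmulr_rgt0.
    - by rewrite ltr_pXn2r ?nnegrE ?expR_ge0// expR_gt1 pmulr_rgt0.
  move=> /eqP; rewrite sqrf_eq0 => /eqP/ComplexField.Normc.eq0_normc Q1.
  move=> /eqP; rewrite sqrf_eq0 => /eqP/ComplexField.Normc.eq0_normc Q2.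
  by move: q0; rewrite Q1 Q2 eqxx.
(* Since [Re c] is [- (2 * pi)] times [Im z], the eigenvalue is real. *)
have zE : (complex.Re z)%:C = z.
  move/eqP: Re_c; rewrite Re_tau mulf_eq0 oppr_eq0 mulf_eq0 pnatr_eq0/=.
  rewrite gt_eqF ?pi_gt0//=.
  by move=> /eqP Im0; apply/eqP; rewrite eq_complex /= Im0 !eqxx.
exists (complex.Re z) => //.
have := transfer_fixed_char hab B1 B2 q0.
by rewrite D_cexp -!cexp_tau zE.
Qed.

(** * Eigenfunctions carried by the two bounded intervals *)

Section TwoBand.
Variables (c C1 C2 : R[i]).

Definition two_band (x : R) : R[i] :=
  if x \in `]alpha1, beta2[ then C1 * cexp (x%:C * c)
  else if x \in `]alpha2, beta3[ then C2 * cexp (x%:C * c) else 0.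

Lemma two_band1 x : I1 x -> two_band x = C1 * cexp (x%:C * c).
Proof. by rewrite /two_band /I1 /= => ->. Qed.

Lemma two_band2 x : I2 x -> two_band x = C2 * cexp (x%:C * c).
Proof.
rewrite /two_band /I2 /= => xI2; rewrite ifF ?xI2//.
apply/negP; move: xI2; rewrite !in_itv /= => /andP[ax _] /andP[_ xb].
by have := lt_trans (lt_trans h3 ax) xb; rewrite ltxx.
Qed.

Lemma two_band0 x : I0 x -> two_band x = 0.
Proof.
rewrite /two_band /I0 /= !in_itv /= => xb.
have xa : x < alpha1 by exact: lt_trans h1.
by rewrite (lt_gtF xa) (lt_gtF (lt_trans xa (lt_trans h2 h3))).
Qed.

Lemma two_band3 x : I3 x -> two_band x = 0.
Proof.
rewrite /two_band /I3 /= !in_itv /= andbT => ax.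
have bx : beta3 < x by exact: lt_trans ax.
by rewrite (lt_gtF bx) (lt_gtF (lt_trans (lt_trans h3 h4) bx)) !andbF.
Qed.

(** Writing zero as an exponential with coefficient 0 puts the half-lines under the same lemmas as
    the bounded intervals. *)
Let two_band0E x : I0 x -> two_band x = 0 * cexp (x%:C * c).
Proof. by rewrite mul0r; exact: two_band0. Qed.

Let two_band3E x : I3 x -> two_band x = 0 * cexp (x%:C * c).
Proof. by rewrite mul0r; exact: two_band3. Qed.

Lemma two_band_derivative x :
  Om x -> has_derivative two_band x (c * two_band x).
Proof.
have dI (J : interval R) C : open [set` J] ->
    (forall y, [set` J] y -> two_band y = C * cexp (y%:C * c)) ->
    [set` J] x -> has_derivative two_band x (c * two_band x).
  by move=> oJ fE; exact: (cexp_scaled_open_derivative oJ fE).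
case=> [[[]|]|].
- by apply: (dI `]-oo, beta1[ 0).
- by apply: (dI `]alpha1, beta2[ C1) => // y; exact: two_band1.
- by apply: (dI `]alpha2, beta3[ C2) => // y; exact: two_band2.
- by apply: (dI `]alpha3, +oo[ 0).
Qed.

Lemma two_band_L2 : complex.Re c = 0 -> L2 Om two_band.
Proof.
move=> Rc0.
have [R0 M0] := measurable_cexp_scaled two_band0E (measurable_itv _).
have [R1 M1] := measurable_cexp_scaled two_band1 (measurable_itv _).
have [R2 M2] := measurable_cexp_scaled two_band2 (measurable_itv _).
have [R3 M3] := measurable_cexp_scaled two_band3E (measurable_itv _).
(* One bounded interval contains both bands, and for [Re c = 0] the moduli on them are constant. *)
have mI : measurable (`]alpha1, beta3[%classic : set R) by exact: measurable_itv.
apply: (L2_upper_bound (M := normc C1 + normc C2) measurable_Om mI).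
- by rewrite lebesgue_measure_itv /=; case: ifP => _; rewrite ?ltry// -EFinB ltry.
- exact: measurable_Om_fun.
- exact: measurable_Om_fun.
have normE C x : normc (C * cexp (x%:C * c)) = normc C.
  by rewrite normc_cexp_scaled Rc0 mulr0 expR0 mulr1.
move=> x; case=> [[[]|]|] Jx.
- rewrite two_band0// ComplexField.Normc.normc0.
  by rewrite mulr_ge0 ?addr_ge0 ?normc_nonneg.
- rewrite two_band1// normE indicE mem_set ?mulr1 ?lerDl ?normc_nonneg//.
  move: Jx; rewrite /J1 /= !in_itv /= => /andP[-> xb].
  exact: lt_trans xb (lt_trans h3 h4).
- rewrite two_band2// normE indicE mem_set ?mulr1 ?lerDr ?normc_nonneg//.
  move: Jx; rewrite /J2 /= !in_itv /= => /andP[ax ->].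
  by rewrite (lt_trans (lt_trans h2 h3) ax).
- rewrite two_band3// ComplexField.Normc.normc0.
  by rewrite mulr_ge0 ?addr_ge0 ?normc_nonneg.
Qed.

Lemma two_band_boundary :
  mx_B a b *m col3 0 (C1 * cexp (beta2%:C * c)) (C2 * cexp (beta3%:C * c)) =
  col3 (C1 * cexp (alpha1%:C * c)) (C2 * cexp (alpha2%:C * c)) 0 ->
  boundary_condition beta1 alpha1 beta2 alpha2 beta3 alpha3 (mx_B a b) two_band.
Proof.
move=> BC; exists 0, (C1 * cexp (beta2%:C * c)), (C2 * cexp (beta3%:C * c)).
exists (C1 * cexp (alpha1%:C * c)), (C2 * cexp (alpha2%:C * c)), 0.
have E1 x : alpha1 < x < beta2 -> two_band x = C1 * cexp (x%:C * c).
  by move=> xb; apply: two_band1; rewrite /I1 /= in_itv.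
have E2 x : alpha2 < x < beta3 -> two_band x = C2 * cexp (x%:C * c).
  by move=> xb; apply: two_band2; rewrite /I2 /= in_itv.
split; last split=> //; split.
- rewrite -[X in _ --> X](mul0r (cexp (beta1%:C * c))).
  apply: (@cexp_scaled_left_limit _ _ _ _ (beta1 - 1)); first by rewrite gtrBl.
  by move=> x /andP[_ xb]; apply: two_band0E; rewrite /I0 /= in_itv.
- exact: cexp_scaled_left_limit h2 E1.
- exact: cexp_scaled_left_limit h4 E2.
- exact: cexp_scaled_right_limit h2 E1.
- exact: cexp_scaled_right_limit h4 E2.
- rewrite -[X in _ --> X](mul0r (cexp (alpha3%:C * c))).
  apply: (@cexp_scaled_right_limit _ _ _ _ _ (alpha3 + 1)); first by rewrite ltrDl.
  by move=> x /andP[xa _]; apply: two_band3E; rewrite /I3 /= in_itv /= xa.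
Qed.

(** The function has no zero on the first band, which has positive measure. *)
Lemma two_band_nonzero : C1 != 0 -> ~ ae_eq_on Om two_band (fun=> 0).
Proof.
move=> C10 ae0.
have [A [mA A0 NA]] : (@lebesgue_measure R).-negligible I1.
  apply: negligibleS ae0 => x I1x /= /(_ (I1Om I1x)); rewrite two_band1//.
  by move/eqP; rewrite mulf_eq0 (negPf C10) (negPf (cexp_neq0 _)).
have : (lebesgue_measure I1 <= lebesgue_measure A)%E.
  by apply: le_measure; rewrite ?inE//; exact: measurable_itv.
rewrite [X in (_ <= X)%E]A0.
by rewrite /I1 lebesgue_measure_itv /= lte_fin h2 -EFinB lee_fin leNgt subr_gt0 h2.
Qed.
End TwoBand.

(** Makes the derivative another two-band function, so that its square integrability follows from
    [two_band_L2]. *)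
Lemma scale_two_band (k c C1 C2 : R[i]) (x : R) :
  k * two_band c C1 C2 x = two_band c (k * C1) (k * C2) x.
Proof.
by rewrite /two_band; case: ifP => _; rewrite ?mulrA//; case: ifP; rewrite ?mulrA ?mulr0.
Qed.

Lemma D_point_spectrum (lambda : R) :
  `|a| ^+ 2 + `|b| ^+ 2 = 1 -> b != 0 ->
  D lambda a (beta2 - alpha1) (beta3 - alpha2) = 0 ->
  point_spectrum beta1 alpha1 beta2 alpha2 beta3 alpha3 (mx_B a b) lambda%:C.
Proof.
move=> hab b0; rewrite D_cexp => D0.
set E1 := e_ lambda _ in D0; set E2 := e_ lambda (beta3 - _) in D0.
(* The kernel vector prescribes the values at [alpha1] and [alpha2]; dividing by the exponentials
   there gives the amplitudes [C1] and [C2]. *)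
pose x := b * E2; pose y := 1 - a * E1; pose c := tau * lambda%:C.
have [Bx By] := transfer_fixed_vector hab D0.
pose C1 := x / cexp (alpha1%:C * c); pose C2 := y / cexp (alpha2%:C * c).
have C1E : C1 * cexp (alpha1%:C * c) = x by rewrite /C1 divfK// cexp_neq0.
have C2E : C2 * cexp (alpha2%:C * c) = y by rewrite /C2 divfK// cexp_neq0.
have shift C s t : C * cexp (t%:C * c) =
    cexp ((t - s)%:C * c) * (C * cexp (s%:C * c)).
  by rewrite [RHS]mulrCA -cexpD -mulrDl -rmorphD subrK.
have E1E : C1 * cexp (beta2%:C * c) = E1 * x.
  by rewrite (shift _ alpha1) C1E cexp_tau.
have E2E : C2 * cexp (beta3%:C * c) = E2 * y.
  by rewrite (shift _ alpha2) C2E cexp_tau.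
have Rc0 : complex.Re c = 0 by rewrite Re_tau /= mulr0.
(* Here [b != 0] enters: it makes [x = b * E2] nonzero. *)
have C10 : C1 != 0.
  rewrite /C1 mulf_neq0 ?invr_eq0 ?cexp_neq0// /x mulf_neq0//.
  by rewrite /E2 /e_ e_neq0.
exists (two_band c C1 C2), (fun t => lambda%:C * two_band c C1 C2 t); split.
- exists (fun t => c * two_band c C1 C2 t); last first.
    by move=> t; rewrite mulrA /c mulrA mulVf ?mul1r.
  split.
  + exact: two_band_L2.
  + split.
    * by apply: cst0_abs_continuous => t; exact: two_band0.
    * apply: (@cexp_scaled_abs_continuous _ _ C1 c) => t tb.
      by apply: two_band1; rewrite /I1 /= in_itv.
    * apply: (@cexp_scaled_abs_continuous _ _ C2 c) => t tb.
      by apply: two_band2; rewrite /I2 /= in_itv.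
    * by apply: cst0_abs_continuous => t; exact: two_band3.
  + split; first by apply: aeW => t; exact: two_band_derivative.
    rewrite (_ : (fun _ => _) = two_band c (c * C1) (c * C2)).
      exact: two_band_L2.
    by apply/funext => t; rewrite scale_two_band.
  + apply: two_band_boundary; rewrite E1E E2E C1E C2E.
    by apply/mx_B_mulP; rewrite Bx By.
- exact: two_band_nonzero.
- by apply: aeW.
Qed.
End Spectrum.

Theorem theorem5p6 (R : realType)
    (beta1 alpha1 beta2 alpha2 beta3 alpha3 : R) (a b : R[i])
    (h1 : beta1 < alpha1) (h2 : alpha1 < beta2) (h3 : beta2 < alpha2)
    (h4 : alpha2 < beta3) (h5 : beta3 < alpha3)
    (hab : `|a| ^+ 2 + `|b| ^+ 2 = 1) (hb : 0 < `|b| < 1) :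
  let L1 := beta2 - alpha1 in
  let L2 := beta3 - alpha2 in
  [/\ mx_B a b \is unitarymx,
      forall lambda : R,
        \det (1%:M - mx_B' alpha1 beta2 alpha2 beta3 a b lambda) =
        D lambda a L1 L2,
      point_spectrum beta1 alpha1 beta2 alpha2 beta3 alpha3 (mx_B a b) =
        [set lambda%:C | lambda in Z a L1 L2] &
      forall w phi0 : R, 0 < w < 1 -> a = w%:C * e phi0 ->
        forall lambda : R,
          D lambda a L1 L2 = 0 <->
          e (lambda * L2 - phi0) =
            (1 - w%:C * e (lambda * L1 + phi0)) /
            (w%:C - e (lambda * L1 + phi0))].
Proof.
move=> L1 L2; split.
- exact: mx_B_unitary.
- by move=> lambda; exact: det_mx_B'.
- apply/seteqP; split=> [z|_ [lambda Dl <-]].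
    by move=> /(point_spectrum_D h2 h4 hab)[] // lambda Dl <-; exists lambda.
  have b0 : b != 0 by case/andP: hb; rewrite normr_gt0.
  exact: D_point_spectrum.
- by move=> w phi0 w01 aE lambda; exact: D_eq0_div w01 aE _ _ _.
Qed.
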